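(* Let $n\ge 2$, let $f\in\mathcal{S}(\mathbb{R}^n;S^m(\mathbb{R}^n))$ be a symmetric $m$-tensor field in $\mathbb{R}^n$, and let $D^{k,m}f$ be its $k$-weighted divergent beam ray transform, for $k\in\mathbb{Z}^+\cup\{0\}$. Then $f(x)$ can be recovered pointwise from the knowledge of $D^{k,m}f(x,\xi)$ for a finite set of directions $\xi$.
   Context: $\mathcal{S}(\mathbb{R}^n;S^m(\mathbb{R}^n))$ is the space of symmetric $m$-tensor fields $f=(f_{i_1\cdots i_m})$ on $\mathbb{R}^n$ whose components are complex-valued Schwartz functions, symmetric in all indices. Repeated indices are summed from $1$ to $n$. For a non-negative integer $k$, the $k$-th weighted divergent beam ray transform of $f$ is $$D^{k,m}f(x,\xi)=\int_0^\infty t^k f_{i_1\cdots i_m}(x+t\xi)\,\xi^{i_1}\cdots\xi^{i_m}\,dt,$$ where $x\in\mathbb{R}^n$ is the source point and $\xi\in\mathbb{S}^{n-1}$ is the unit vector indicating the direction of the beam. *)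

(* Defs.v *)
From HB Require Import structures.
From mathcomp Require Export all_boot all_order all_algebra.
From mathcomp Require Export fingroup perm.
From mathcomp Require Export complex.
From mathcomp Require Export all_classical all_reals all_analysis.

Set Implicit Arguments.
Unset Strict Implicit.
Unset Printing Implicit Defensive.

Export Order.TTheory GRing.Theory Num.Theory.
Export numFieldNormedType.Exports.

Global Open Scope classical_set_scope.
Global Open Scope complex_scope.
Global Open Scope ring_scope.

(* The norm that MathComp-Analysis puts on 'rV[R]_n is the sup norm, so the
   Euclidean sphere has to be spelled out. *)
Definition unit_sphere (R : realType) (n : nat) : set 'rV[R]_n :=
  [set xi : 'rV[R]_n | \sum_(i < n) xi 0 i ^+ 2 = 1].

(* Iterated partial derivatives: the list [:: i1; ...; ip] stands for the
   operator d_{i1} ... d_{ip}. *)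
Definition pderivs (R : realType) (n : nat) (s : seq 'I_n)
    (g : 'rV[R]_n -> R) : 'rV[R]_n -> R :=
  foldr (fun i h x => 'D_(delta_mx 0 i) h x) g s.

(* 'D is a total operator, so smoothness is a separate requirement: every
   iterated partial derivative is (Frechet) differentiable everywhere. *)
Definition smooth (R : realType) (n : nat) (g : 'rV[R]_n -> R) : Prop :=
  forall (s : seq 'I_n) (x : 'rV[R]_n), differentiable (pderivs s g) x.

Definition real_schwartz (R : realType) (n : nat) (g : 'rV[R]_n -> R) : Prop :=
  smooth g /\
  forall (a : 'I_n -> nat) (s : seq 'I_n), exists C : R, forall x : 'rV[R]_n,
    `|(\prod_(i < n) x 0 i ^+ a i) * pderivs s g x| <= C.

(* R[i] carries no normed-module structure over R here, so calculus on
   complex-valued functions goes through real and imaginary parts. *)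
Definition schwartz (R : realType) (n : nat) (g : 'rV[R]_n -> R[i]) : Prop :=
  real_schwartz (fun x => complex.Re (g x)) /\
  real_schwartz (fun x => complex.Im (g x)).

Definition tensor (R : realType) (n m : nat) : Type :=
  {ffun m.-tuple 'I_n -> R[i]}.

Definition symmetric_tensor (R : realType) (n m : nat) (u : tensor R n m) :
    Prop :=
  forall (s : 'S_m) (i : m.-tuple 'I_n),
    u [tuple tnth i (s j) | j < m] = u i.

Definition schwartz_symmetric_tensor_field (R : realType) (n m : nat)
    (f : 'rV[R]_n -> tensor R n m) : Prop :=
  (forall x, symmetric_tensor (f x)) /\
  (forall i : m.-tuple 'I_n, schwartz (fun x => f x i)).

Definition contract (R : realType) (n m : nat) (u : tensor R n m)
    (xi : 'rV[R]_n) : R[i] :=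
  \sum_(i : m.-tuple 'I_n) u i * \prod_(j < m) (xi 0 (tnth i j))%:C.

Definition cintegral (R : realType) (D : set R) (h : R -> R[i]) : R[i] :=
  (\int[@lebesgue_measure R]_(t in D) complex.Re (h t)) +i*
  (\int[@lebesgue_measure R]_(t in D) complex.Im (h t)).

Definition divergent_beam (R : realType) (n m k : nat)
    (f : 'rV[R]_n -> tensor R n m) (x xi : 'rV[R]_n) : R[i] :=
  cintegral `[0, +oo[ (fun t => (t ^+ k)%:C * contract (f (x + t *: xi)) xi).

(* A reconstruction procedure sends data d(y, xi) to a tensor field.  It is
   pointwise from the directions in Xi when its output at x depends only on the
   values d(y, xi) with xi in Xi and source points y arbitrarily close to x. *)
Definition pointwise_from (R : realType) (n m : nat) (Xi : set 'rV[R]_n)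
    (rec : ('rV[R]_n -> 'rV[R]_n -> R[i]) -> 'rV[R]_n -> tensor R n m) : Prop :=
  forall (d d' : 'rV[R]_n -> 'rV[R]_n -> R[i]) (x : 'rV[R]_n),
    (\forall y \near x, forall xi, Xi xi -> d y xi = d' y xi) ->
    rec d x = rec d' x.

(* Main.v *)
(* Write phi(t) for a real or imaginary part of f(x + t xi) contracted m times
   with xi.  If the k-th beam data of phi vanish at all s in [0, e), then for
   such s
     P(s) = int_0^oo (u - s)^k phi(u) du = int_0^s (u - s)^k phi(u) du,
   where P is a polynomial of degree at most k, while the right-hand side is
   O(s^(k+1)).  Hence P = 0; but if phi(0) <> 0 the right-hand side is nonzero
   for small s > 0, so phi(0) = 0.  Thus the data near x along xi determine
   f(x) contracted with xi, without differentiating them.  Polarization then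
   recovers the symmetric tensor f(x) from the finitely many directions
   e_{i_1} + ... + e_{i_p}, p <= m, normalized. *)
Require Import Defs.
From mathcomp Require Import measurable_realfun ring lra.

Set Implicit Arguments.
Unset Strict Implicit.
Unset Printing Implicit Defensive.

Local Notation mu := lebesgue_measure.

(** * Polarization *)

(** The product over [l] is the indicator that [S] contains the image of [a], so the sum factors
    over [j]: each [j] in the image contributes 1, each [j] outside contributes 1 - 1 = 0. Hence it
    detects surjectivity, which for a self-map of ['I_m] is injectivity. *)
Lemma sum_sign_cover (A : comPzRingType) (m : nat) (a : {ffun 'I_m -> 'I_m}) :
  \sum_(S : {ffun 'I_m -> bool})
    (\prod_j (-1) ^+ ~~ S j) * (\prod_l (S (a l))%:R) =
  (injectiveb a)%:R :> A.
Proof.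
pose G (j : 'I_m) (b : bool) : A :=
  (-1) ^+ (~~ b) * (if j \in codom a then b%:R else 1).
transitivity (\sum_(S : {ffun 'I_m -> bool}) \prod_j G j (S j)).
  apply: eq_bigr => S _; rewrite big_split/=; congr (_ * _).
  have [aS|] := boolP [forall l, S (a l)].
    rewrite !big1// => [j _|l _]; last by rewrite (forallP aS).
    by case: ifP => // /codomP[l ->]; rewrite (forallP aS).
  rewrite negb_forall => /existsP[l /negPf Sl].
  rewrite (bigD1 l)//= Sl mul0r (bigD1 (a l))//= codom_f Sl.
  by rewrite mul0r.
rewrite -bigA_distr_bigA/=.
have -> : \prod_(j < m) \sum_(b : bool) G j b = \prod_(j < m) (j \in codom a)%:R.
  apply: eq_bigr => j _; rewrite big_bool /G/= expr0 expr1 mul1r mulN1r.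
  by case: (j \in codom a); rewrite ?subr0 ?subrr.
have [ai|ai] := boolP (injectiveb a).
  rewrite big1// => j _; have /injectiveP/injF_onto-> := ai; exact/eqP/eqP.
have [j jNa] : exists j, j \notin codom a.
  apply/existsP; rewrite -negb_forall; apply: contra ai => /forallP aall.
  apply/injectiveP; apply: in2T; apply/image_injP.
  by apply/eqP/eq_card => j; rewrite [LHS]aall.
by rewrite (bigD1 j)//= (negPf jNa) mul0r.
Qed.

(** The vector sum of the basis vectors e_{i_j} over the j in [S], with [S] given by its
    characteristic function. *)
Definition subset_sum (A : pzRingType) (n m : nat) (i : m.-tuple 'I_n)
    (S : {ffun 'I_m -> bool}) : 'rV[A]_n :=
  \row_c \sum_(j < m) (S j)%:R * (tnth i j == c)%:R.

(* Only surjective index maps [a] survive the signed sum over [S], and on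
   ['I_m] these are the permutations. *)
Lemma polarization (A : comPzRingType) (n m : nat) (u : m.-tuple 'I_n -> A)
    (i : m.-tuple 'I_n) :
  (forall (s : 'S_m) (i : m.-tuple 'I_n), u [tuple tnth i (s j) | j < m] = u i) ->
  \sum_(S : {ffun 'I_m -> bool}) (\prod_j (-1) ^+ ~~ S j) *
    (\sum_(b : m.-tuple 'I_n) u b * \prod_l subset_sum A i S 0 (tnth b l)) =
  u i *+ m`!.
Proof.
move=> usym.
(* Distributing the product over [l] produces a sum over all maps [a]; the Kronecker deltas leave
   only the multi-index [b] = i o a. *)
have expand (S : {ffun 'I_m -> bool}) :
    \sum_(b : m.-tuple 'I_n) u b * \prod_l subset_sum A i S 0 (tnth b l) =
    \sum_(a : {ffun 'I_m -> 'I_m})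
      (\prod_l (S (a l))%:R) * u [tuple tnth i (a l) | l < m].
  under eq_bigr => b _.
    under [X in _ * X]eq_bigr do rewrite mxE.
    rewrite bigA_distr_bigA mulr_sumr/=.
    under eq_bigr do rewrite big_split/= mulrCA.
    over.
  rewrite exchange_big/=; apply: eq_bigr => a _.
  rewrite -mulr_sumr; congr (_ * _).
  rewrite (bigD1 [tuple tnth i (a l) | l < m])//= big1 ?mulr1; last first.
    by move=> l _; rewrite tnth_mktuple eqxx.
  rewrite big1 ?addr0// => b /eqP bi.
  have [l lb] : exists l, tnth i (a l) != tnth b l.
    apply/existsP; rewrite -negb_forall; apply/negP => /forallP ib; apply: bi.
    by apply: eq_from_tnth => l; rewrite tnth_mktuple (eqP (ib l)).
  by rewrite (bigD1 l)//= (negPf lb) mul0r mulr0.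
under eq_bigr do rewrite expand mulr_sumr.
rewrite exchange_big/=.
under eq_bigr => a _.
  under eq_bigr do rewrite mulrA.
  rewrite -mulr_suml sum_sign_cover.
  over.
rewrite (bigID (fun a : {ffun 'I_m -> 'I_m} => injectiveb a))/=.
rewrite [X in _ + X]big1 ?addr0; last by move=> a /negPf->; rewrite mul0r.
(* Reindexes the injective maps by permutations; the identity is a default for maps that are not
   injective, which no longer occur in the sum. *)
pose perm_or_id (a : {ffun 'I_m -> 'I_m}) : 'S_m := insubd (1%g : 'S_m) a.
rewrite (reindex_onto (fun s : 'S_m => pval s) perm_or_id)/=; last first.
  by move=> a ai; exact: (insubdK (1%g : 'S_m) ai).
under eq_bigr => s /andP[si _].
  rewrite si mul1r.
  have -> : u [tuple tnth i (pval s l) | l < m] = u i.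
    rewrite -[RHS](usym s); congr u; apply: eq_from_tnth => l.
    by rewrite !tnth_mktuple unlock.
  over.
rewrite sumr_const; congr (_ *+ _).
rewrite -[RHS](_ : #|'S_m| = _); last exact: card_Sn.
apply: eq_card => s; rewrite !inE unfold_in; apply/andP; split; first exact: (valP s).
apply/eqP; rewrite /perm_or_id; apply: val_inj; exact: (insubdK (1%g : 'S_m) (valP s)).
Qed.

(** * One-dimensional moment problem *)

Lemma measurable_shift (R : realType) (s : R) :
  measurable_fun [set: measurableTypeR R] ((+%R s) : _ -> measurableTypeR R).
Proof. exact: measurable_funD. Qed.

(** The pushforward gives half-open intervals their length, which determines Lebesgue measure. *)
Lemma lebesgue_measure_shift (R : realType) (s : R) (A : set R) : measurable A ->
  pushforward mu ((+%R s) : _ -> measurableTypeR R) A = mu A.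
Proof.
move=> mA; have ms := measurable_shift s.
apply/esym/(@lebesgue_measure_unique _ (pushforward mu _)) => //= _ [[a b]] _ <-.
rewrite /pushforward.
have -> : +%R s @^-1` `]a, b] = `]a - s, b - s]%classic.
  by apply/seteqP; split => x; rewrite /= !in_itv/= ltrBlDl lerBrDl.
by rewrite !lebesgue_measure_itv/= !lte_fin ltrD2r opprB -!EFinD addrA subrK.
Qed.

Lemma Rintegral_shift (R : realType) (s : R) (g : R -> R) :
  measurable_fun setT g ->
  mu.-integrable `[0, +oo[ (EFin \o (fun t => g (s + t))) ->
  \int[mu]_(t in `[0, +oo[) g (s + t) = \int[mu]_(u in `[s, +oo[) g u.
Proof.
move=> mg ig; rewrite /Rintegral; congr fine.
have pE : (+%R s : _ -> measurableTypeR R) @^-1` `[s, +oo[ = `[0, +oo[%classic.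
  by apply/seteqP; split => x /=; rewrite !in_itv/= !andbT lerDl.
rewrite -pE.
transitivity (\int[pushforward mu (+%R s : _ -> measurableTypeR R)]_(u in `[s, +oo[) (g u)%:E)%E.
  rewrite integral_pushforward//= ?pE//.
  - exact: measurable_shift.
  - exact/measurable_EFinP.
apply: eq_measure_integral => [|ms A mA _]; first exact: measurable_shift.
exact: lebesgue_measure_shift.
Qed.

(** * Rapidly decreasing functions on the half-line *)

(** What is kept of the Schwartz property along a beam: decay is asked only in the direction of
    integration, and no derivatives enter. *)
Definition rapid (R : realType) (phi : R -> R) :=
  continuous phi /\
  forall p, exists C : R, forall t, 0 <= t -> t ^+ p * `|phi t| <= C.

Lemma rapid0 (R : realType) : rapid (fun _ : R => 0 : R).
Proof.
split; first exact: cst_continuous.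
by move=> p; exists 0 => t t0; rewrite normr0 mulr0.
Qed.

Lemma rapidD (R : realType) (phi psi : R -> R) :
  rapid phi -> rapid psi -> rapid (fun t => phi t + psi t).
Proof.
move=> [cphi bphi] [cpsi bpsi]; split.
  by move=> x; apply: cvgD; [exact: cphi|exact: cpsi].
move=> p; have [C hC] := bphi p; have [D hD] := bpsi p.
exists (C + D) => t t0; apply: le_trans (lerD (hC _ t0) (hD _ t0)).
by rewrite -mulrDr ler_wpM2l ?exprn_ge0// ler_normD.
Qed.

Lemma rapidMr (R : realType) (phi : R -> R) (c : R) :
  rapid phi -> rapid (fun t => phi t * c).
Proof.
move=> [cphi bphi]; split.
  by move=> x; apply: cvgM; [exact: cphi|exact: cvg_cst].
move=> p; have [C hC] := bphi p.
exists (C * `|c|) => t t0.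
by rewrite normrM mulrA ler_wpM2r// hC.
Qed.

Lemma rapidB (R : realType) (phi psi : R -> R) :
  rapid phi -> rapid psi -> rapid (fun t => phi t - psi t).
Proof.
move=> rphi /(rapidMr (-1))/(rapidD rphi); congr rapid.
by apply/funext => t; rewrite mulrN1.
Qed.

Lemma rapid_sum (R : realType) (I : finType) (phi : I -> R -> R) :
  (forall i, rapid (phi i)) -> rapid (fun t => \sum_i phi i t).
Proof.
move=> rphi; have := rapid0 R; move: (index_enum I) => s r0.
elim: s => [|i s ih].
  by congr rapid : r0; apply/funext => t; rewrite big_nil.
have := rapidD (rphi i) ih; congr rapid.
by apply/funext => t; rewrite big_cons.
Qed.

Lemma rapidX (R : realType) (phi : R -> R) (q : nat) :
  rapid phi -> rapid (fun t => t ^+ q * phi t).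
Proof.
move=> [cphi bphi]; split.
  by move=> x; apply: cvgM; [exact: exprn_continuous|exact: cphi].
move=> p; have [C hC] := bphi (p + q)%N.
exists C => t t0; rewrite normrM ger0_norm ?exprn_ge0// mulrA -exprD.
exact: hC.
Qed.

Lemma rapid_shift (R : realType) (phi : R -> R) (s : R) :
  0 <= s -> rapid phi -> rapid (fun t => phi (s + t)).
Proof.
move=> s0 [cphi bphi]; split.
  move=> x; apply: (@continuous_comp _ _ _ (fun t => s + t) phi); last exact: cphi.
  by apply: cvgD; [exact: cvg_cst|exact: cvg_id].
move=> p; have [C hC] := bphi p; exists C => t t0.
apply: le_trans (hC (s + t) _); last by rewrite addr_ge0.
by rewrite ler_wpM2r// lerXn2r ?nnegrE ?addr_ge0// lerDr.
Qed.

(** The bounds C on |phi| and D on t^2 |phi| give the integrable majorant (C + D) / (1 + t^2). *)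
Lemma rapid_integrable (R : realType) (phi : R -> R) :
  rapid phi -> mu.-integrable `[0, +oo[ (EFin \o phi).
Proof.
move=> [cphi bphi].
have [C hC] := bphi 0%N; have [D hD] := bphi 2%N.
have i1 : mu.-integrable `[0, +oo[ (EFin \o (fun t : R => (oneDsqr t)^-1)).
  apply/integrableP; split.
    apply/measurable_EFinP; apply: measurable_funTS.
    apply: continuous_measurable_fun; exact: continuous_oneDsqrV.
  have abs_i1 t : `|(EFin \o (fun t : R => (oneDsqr t)^-1%R)) t|%E =
      ((oneDsqr t)^-1)%:E.
    by rewrite /= ger0_norm// invr_ge0 (le_trans ler01).
  under eq_integral do rewrite abs_i1.
  by rewrite integral0y_oneDsqr ltry.
apply: le_integrable (integrableZl _ (C + D) i1) => //.
  apply/measurable_EFinP; apply: measurable_funTS.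
  exact: continuous_measurable_fun.
move=> t /=; rewrite in_itv/= andbT => t0.
have op : 0 < oneDsqr t by rewrite (lt_le_trans ltr01).
rewrite lee_fin; apply: le_trans (ler_norm _).
rewrite ler_pdivlMr// mulrC mulrDl.
by apply: lerD; [have := hC _ t0|have := hD _ t0]; rewrite ?expr0.
Qed.

Lemma Rintegral_sum_rapid (R : realType) (I : finType) (phi : I -> R -> R) :
  (forall i, rapid (phi i)) ->
  \int[mu]_(t in `[0, +oo[) (\sum_i phi i t) =
  \sum_i \int[mu]_(t in `[0, +oo[) phi i t.
Proof.
move=> rphi; have iphi i := rapid_integrable (rphi i).
rewrite /Rintegral.
transitivity (fine (\sum_i \int[mu]_(t in `[0%R, +oo[) (phi i t)%:E)%E).
  congr fine; rewrite -(integral_sum _ iphi)//.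
  by apply: eq_integral => t _; rewrite sumEFin.
by rewrite sum_fine// => i _; exact: (integrable_fin_num _ (iphi i)).
Qed.

(** * Vanishing of the moment polynomial *)

(** Letting s tend to 0 from the right gives p(0) = 0; dividing by X then lowers both the size and
    the order of the bound by one. *)
Lemma poly_eq0_of_bigO (R : realType) (k : nat) (p : {poly R}) (C d : R) :
  0 < d -> (size p <= k)%N ->
  (forall s, 0 < s -> s < d -> `|p.[s]| <= C * s ^+ k) -> p = 0.
Proof.
move=> d0; elim: k p => [|k ih] p.
  by rewrite leqn0 size_poly_eq0 => /eqP.
move=> sp pC.
have p0 : p.[0] = 0.
  apply/eqP; rewrite -normr_le0.
  have cv : `|p.[s]| @[s --> 0^'+] --> `|p.[0]|.
    apply: cvg_norm; apply: cvg_at_right_filter; exact: continuous_horner.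
  have cv0 : (C * s ^+ k.+1) @[s --> 0^'+] --> C * 0 ^+ k.+1.
    apply: cvg_at_right_filter; apply: cvgM; first exact: cvg_cst.
    exact: exprn_continuous.
  suff : `|p.[0]| <= C * 0 ^+ k.+1 by rewrite expr0n/= mulr0.
  apply: (ler_cvg_to cv cv0); near=> s; apply: pC.
    by near: s; exact: nbhs_right_gt.
  by near: s; exact: nbhs_right_lt.
have /factor_theorem[q pq] : root p 0 by apply/eqP.
rewrite subr0 in pq.
have [q0|q0] := eqVneq q 0; first by rewrite pq q0 mul0r.
suff : q = 0 by move/eqP; rewrite (negPf q0).
apply: ih; first by move: sp; rewrite pq size_mulX// ltnS.
move=> s s0 sd; have := pC _ s0 sd.
rewrite pq hornerM hornerX normrM (gtr0_norm s0) exprSr mulrA.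
by rewrite ler_pM2r.
Unshelve. all: by end_near. Qed.

(* [P] and [H] are the two integrals [int_0^oo (u - s)^k phi(u) du] and
   [int_0^s (u - s)^k phi(u) du] of the header; [H = P] on [[0, e)] because
   their difference is the datum at [s]. *)
Lemma rapid_moment0 (R : realType) (k : nat) (e : R) (phi : R -> R) :
  rapid phi -> 0 < e ->
  (forall s, 0 <= s -> s < e -> \int[mu]_(t in `[0, +oo[) (t ^+ k * phi (s + t)) = 0) ->
  phi 0 = 0.
Proof.
move=> rphi e0 phi0.
(* The hypotheses are stable under [phi] to -[phi]. *)
wlog : phi rphi phi0 / 0 < phi 0.
  move=> wl; have [neg|pos|//] := ltgtP (phi 0) 0; last exact: wl.
  have := wl (fun t => phi t * -1).
  rewrite mulrN1 oppr_gt0 => /(_ (rapidMr _ rphi)) h.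
  apply/eqP; rewrite -oppr_eq0; apply/eqP/h => // s s0 se.
  under eq_Rintegral do rewrite mulrA.
  rewrite RintegralZr ?phi0 ?mul0r//.
  exact/rapid_integrable/rapidX/rapid_shift.
move=> c0; exfalso.
set c := phi 0 in c0.
have [cphi _] := rphi.
pose H s := \int[mu]_(u in `[0, s]) ((u - s) ^+ k * phi u).
pose M j := \int[mu]_(u in `[0, +oo[) (u ^+ j * phi u).
(* Binomial expansion of (u - s)^k in powers of s, integrated against [phi]; the coefficients are
   the moments [M]. *)
pose P : {poly R} := \sum_(i < k.+1) ((-1) ^+ i *+ 'C(k, i) * M (k - i)%N) *: 'X^i.
have expand s u : (u - s) ^+ k * phi u =
    \sum_(i < k.+1) ((u ^+ (k - i) * phi u) * (((-1) ^+ i *+ 'C(k, i)) * s ^+ i)).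
  rewrite exprBn mulr_suml; apply: eq_bigr => i _.
  by rewrite -!mulrnAl -mulr_natl; ring.
have rint s : rapid (fun u => (u - s) ^+ k * phi u).
  under eq_fun do rewrite expand.
  by apply: rapid_sum => i; exact/rapidMr/rapidX.
(* The two sides differ by the integral over u > s, which the substitution u = s + t turns into the
   vanishing datum at s. *)
have HP s : 0 <= s -> s < e -> H s = P.[s].
  move=> s0 se.
  have : \int[mu]_(u in `[0, +oo[) ((u - s) ^+ k * phi u) = P.[s].
    under eq_Rintegral do rewrite expand.
    rewrite Rintegral_sum_rapid; last by move=> i; exact/rapidMr/rapidX.
    rewrite horner_sum; apply: eq_bigr => i _.
    rewrite RintegralZr//; last exact/rapid_integrable/rapidX.
    by rewrite hornerZ hornerXn -/(M _); ring.
  move=> <-; apply/eqP; rewrite -subr_eq0 -oppr_eq0 opprB.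
  rewrite Rintegral_itvB ?bnd_simp//; last exact/rapid_integrable.
  rewrite Rintegral_itv_obnd_cbnd; last first.
    apply: integrableS (rapid_integrable (rint s)) => //.
    by apply: subset_itvr; rewrite bnd_simp.
  rewrite -Rintegral_shift; last 2 first.
    by apply: continuous_measurable_fun; case: (rint s).
    exact/rapid_integrable/(rapid_shift s0 (rint s)).
  under eq_Rintegral do rewrite (addrAC s) subrr add0r.
  by rewrite phi0.
have [d d0 phid] : exists2 d, 0 < d & forall u, 0 <= u -> u <= d -> c / 2 <= phi u <= 2 * c.
  have /nbhs_ballP[d /= d0 hd] : \forall u \near (0 : R), c / 2 <= phi u <= 2 * c.
    near=> u; apply/andP; split; near: u.
      apply: (cvgr_ge _ (cphi 0)); rewrite -/c; lra.
    apply: (cvgr_le _ (cphi 0)); rewrite -/c; lra.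
  (* Halving passes from the open ball to a closed interval. *)
  exists (d / 2); first by rewrite divr_gt0.
  move=> u u0 ud; apply: hd; rewrite /ball/= sub0r normrN ger0_norm//; lra.
have Hint s : mu.-integrable `[0, s] (EFin \o (fun u => (u - s) ^+ k * phi u)).
  apply: integrableS (rapid_integrable (rint s)) => //.
  by apply: subset_itvl; rewrite bnd_simp.
(* On [0, s] both |u - s| <= s and |phi(u)| <= 2c hold, so |H(s)| <= 2c s^(k+1), while [P] has size
   at most k + 1. *)
have P0 : P = 0.
  apply: (@poly_eq0_of_bigO _ k.+1 _ (2 * c) (Num.min d e)).
  - by rewrite lt_min d0.
  - rewrite (leq_trans (size_sum _ _ _))//; apply/bigmax_leqP => i _.
    by rewrite (leq_trans (size_scale_leq _ _))// size_polyXn.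
  - move=> s s0; rewrite lt_min => /andP[sd se].
    rewrite -HP ?(ltW s0)//.
    apply: le_trans (le_normr_Rintegral _ (Hint s)) _ => //.
    have -> : 2 * c * s ^+ k.+1 = \int[mu]_(u in `[0, s]) (2 * c * s ^+ k).
      by rewrite Rintegral_cst//= lebesgue_measure_itv/= lte_fin s0/= subr0 exprSr mulrA.
    apply: le_Rintegral => //.
    + exact/integrable_norm.
    + apply: continuous_compact_integrable => //; first exact: segment_compact.
      by apply: continuous_subspaceT => ?; exact: cvg_cst.
    + move=> u /=; rewrite in_itv/= => /andP[u0 us].
      have /andP[h1 h2] := phid u u0 (le_trans us (ltW sd)).
      rewrite normrM normrX [leRHS]mulrC.
      apply: ler_pM => //.
        rewrite lerXn2r ?nnegrE// ?(ltW s0)// ler0_norm ?subr_le0//.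
        by rewrite opprB gerBl.
      by rewrite ger0_norm// (le_trans _ h1)// divr_ge0// ltW.
pose s := Num.min d e / 2.
have m0 : 0 < Num.min d e by rewrite lt_min d0.
have s0 : 0 < s by rewrite divr_gt0.
have sm : s < Num.min d e by rewrite /s; lra.
have [sd se] : s < d /\ s < e by move: sm; rewrite lt_min => /andP.
(* The sign turns (u - s)^k into (s - u)^k, which makes the integrand nonnegative on [0, s]; the aim
   is to show that this integral is positive. *)
have /eqP : (-1) ^+ k * H s = 0 by rewrite HP ?(ltW s0)// P0 horner0 mulr0.
have gE u : (-1) ^+ k * ((u - s) ^+ k * phi u) = (s - u) ^+ k * phi u.
  by rewrite mulrA -exprMn mulN1r opprB.
rewrite -RintegralZl//.
under eq_Rintegral do rewrite gE.
have ig : mu.-integrable `[0, s] (EFin \o (fun u => (s - u) ^+ k * phi u)).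
  rewrite (_ : _ \o _ = (fun u => ((-1) ^+ k)%:E * ((u - s) ^+ k * phi u)%:E)%E).
    exact: integrableZl.
  by apply/funext => u; rewrite /= -gE EFinM.
have g0 u : 0 <= u -> u <= s -> 0 <= (s - u) ^+ k * phi u.
  move=> u0 us; have /andP[h _] := phid u u0 (le_trans us (ltW sd)).
  by rewrite mulr_ge0// ?exprn_ge0 ?subr_ge0// (le_trans _ h)// divr_ge0// ltW.
(* Splitting at s/2: the right half is nonnegative, and on the left half the integrand is at least
   (s/2)^k c/2 > 0. *)
rewrite -(subrK (\int[mu]_(u in `[0, s / 2]) ((s - u) ^+ k * phi u))
  (\int[mu]_(u in `[0, s]) _)).
have s20 : 0 < s / 2 by rewrite divr_gt0.
have s2s : s / 2 <= s by lra.
rewrite Rintegral_itvB ?bnd_simp ?(ltW s20)//.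
apply/negP; rewrite gt_eqF//; apply: ltr_wpDl.
  apply: Rintegral_ge0 => u /=; rewrite in_itv/= => /andP[su us].
  by apply: g0 => //; rewrite (le_trans (ltW s20))// ltW.
apply: (@lt_le_trans _ _ (\int[mu]_(u in `[0, s / 2]) ((s / 2) ^+ k * (c / 2)))).
  rewrite Rintegral_cst//= lebesgue_measure_itv/= lte_fin s20/= subr0.
  by rewrite !mulr_gt0 ?exprn_gt0// invr_gt0.
apply: le_Rintegral => //.
- apply: continuous_compact_integrable => //; first exact: segment_compact.
  by apply: continuous_subspaceT => ?; exact: cvg_cst.
- by apply: integrableS ig => //; apply: subset_itvl; rewrite bnd_simp.
- move=> u /=; rewrite in_itv/= => /andP[u0 us].
  have us' : u <= s by exact: le_trans us s2s.
  have /andP[h _] := phid u u0 (le_trans us' (ltW sd)).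
  apply: ler_pM => //.
  + exact/exprn_ge0/ltW.
  + by rewrite divr_ge0// ltW.
  rewrite lerXn2r ?nnegrE ?subr_ge0//; first exact: ltW.
  by rewrite lerBrDr; lra.
Unshelve. all: by end_near. Qed.

(** * Tensor fields and directions *)

(** Real counterpart of [contract]: directions are real, so contraction commutes with real and
    imaginary parts. *)
Definition rcontract (R : realType) (n m : nat) (v : m.-tuple 'I_n -> R)
    (xi : 'rV[R]_n) : R :=
  \sum_(i : m.-tuple 'I_n) v i * \prod_(j < m) xi 0 (tnth i j).

Lemma rcontractZ (R : realType) (n m : nat) (v : m.-tuple 'I_n -> R) (c : R)
    (xi : 'rV[R]_n) :
  rcontract v (c *: xi) = c ^+ m * rcontract v xi.
Proof.
rewrite /rcontract mulr_sumr; apply: eq_bigr => i _.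
under eq_bigr do rewrite mxE.
by rewrite big_split/= prodr_const card_ord mulrCA.
Qed.

Lemma Re_contract (R : realType) (n m : nat) (u : tensor R n m) (xi : 'rV[R]_n) :
  complex.Re (contract u xi) = rcontract (fun i => complex.Re (u i)) xi.
Proof.
rewrite /contract raddf_sum; apply: eq_bigr => i _.
rewrite -rmorph_prod; case: (u i) => a b /=.
by rewrite mulr0 subr0.
Qed.

Lemma Im_contract (R : realType) (n m : nat) (u : tensor R n m) (xi : 'rV[R]_n) :
  complex.Im (contract u xi) = rcontract (fun i => complex.Im (u i)) xi.
Proof.
rewrite /contract raddf_sum; apply: eq_bigr => i _.
rewrite -rmorph_prod; case: (u i) => a b /=.
by rewrite mulr0 add0r.
Qed.

(** * The finite set of directions *)

Definition enorm (R : realType) (n : nat) (v : 'rV[R]_n) : R :=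
  Num.sqrt (\sum_i v 0 i ^+ 2).

(* The value at [0] is an arbitrary unit vector, so that [v = |v| *: normalize v]
   holds without exception, also in tensor degree [m = 0]. *)
Definition normalize (R : realType) (n : nat) (v : 'rV[R]_n.+1) : 'rV[R]_n.+1 :=
  if enorm v == 0 then delta_mx 0 0 else (enorm v)^-1 *: v.

Lemma normalize_unit (R : realType) (n : nat) (v : 'rV[R]_n.+1) :
  unit_sphere (normalize v).
Proof.
rewrite /unit_sphere/= /normalize; case: eqVneq => [_|v0].
  rewrite (bigD1 0)//= mxE !eqxx expr1n big1 ?addr0// => i /negPf i0.
  by rewrite mxE i0 expr0n.
under eq_bigr do rewrite mxE exprMn.
rewrite -mulr_sumr exprVn sqr_sqrtr ?mulVf ?sumr_ge0//; last first.
  by move=> i _; exact: sqr_ge0.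
by apply: contra v0 => /eqP s0; rewrite /enorm s0 sqrtr0.
Qed.

Lemma enorm_normalize (R : realType) (n : nat) (v : 'rV[R]_n.+1) :
  v = enorm v *: normalize v.
Proof.
rewrite /normalize; case: eqVneq => [v0|v0]; last by rewrite scalerA mulfV ?scale1r.
rewrite v0 scale0r; apply/rowP => i; rewrite mxE.
move/eqP: v0; rewrite sqrtr_eq0 => s0; apply/eqP; rewrite -sqrf_eq0.
rewrite eq_le sqr_ge0 andbT; apply: le_trans s0.
by rewrite (bigD1 i)//= lerDl sumr_ge0// => j _; exact: sqr_ge0.
Qed.

(** The normalized vectors of the polarization identity. They depend on the dimension and the degree
    only; an empty [S] contributes the default unit vector. *)
Definition directions (R : realType) (n m : nat) : set 'rV[R]_n.+1 :=
  range (fun p : m.-tuple 'I_n.+1 * {ffun 'I_m -> bool} =>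
    normalize (subset_sum R p.1 p.2)).

Arguments directions : clear implicits.

Lemma finite_directions (R : realType) (n m : nat) :
  finite_set (directions R n m).
Proof. exact/finite_image/finite_finset. Qed.

(** Polarization writes m! v_i as a signed sum of contractions with subset sums, and by homogeneity
    each is a multiple of a contraction with a unit direction. *)
Lemma rcontract_eq0 (R : realType) (n m : nat) (v : m.-tuple 'I_n.+1 -> R) :
  (forall (s : 'S_m) (i : m.-tuple 'I_n.+1), v [tuple tnth i (s j) | j < m] = v i) ->
  (forall xi, directions R n m xi -> rcontract v xi = 0) ->
  forall i, v i = 0.
Proof.
move=> vsym v0 i; apply/eqP; have := polarization i vsym.
rewrite big1 => [/esym/eqP|S _]; first by rewrite mulrn_eq0 gtn_eqF ?fact_gt0.
rewrite -/(rcontract v (subset_sum R i S)) [subset_sum R i S]enorm_normalize.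
by rewrite rcontractZ v0 ?mulr0//; exists (i, S).
Qed.

Lemma exprD_le (R : realType) (p : nat) (a b : R) : 0 <= a -> 0 <= b ->
  (a + b) ^+ p <= 2 ^+ p * (a ^+ p + b ^+ p).
Proof.
move=> a0 b0; have [ab|/ltW ba] := leP a b.
  apply: (@le_trans _ _ ((2 * b) ^+ p)).
    by rewrite lerXn2r ?nnegrE ?addr_ge0 ?mulr_ge0//; lra.
  by rewrite exprMn ler_wpM2l ?exprn_ge0// lerDr exprn_ge0.
apply: (@le_trans _ _ ((2 * a) ^+ p)).
  by rewrite lerXn2r ?nnegrE ?addr_ge0 ?mulr_ge0//; lra.
by rewrite exprMn ler_wpM2l ?exprn_ge0// lerDl exprn_ge0.
Qed.

(** * Restriction to lines *)

Lemma continuous_line (R : realType) (n : nat) (x xi : 'rV[R]_n) :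
  continuous (fun t : R => x + t *: xi).
Proof.
by move=> t; apply: cvgD; [exact: cvg_cst|apply: cvgZr_tmp; exact: cvg_id].
Qed.

(** A unit vector has a coordinate xi_i <> 0; with y = x + t xi, t xi_i = y_i - x_i, so powers of t
    are controlled by powers of y_i, against which g is bounded. *)
Lemma rapid_real_schwartz (R : realType) (n : nat) (g : 'rV[R]_n -> R)
    (x xi : 'rV[R]_n) :
  unit_sphere xi -> real_schwartz g -> rapid (fun t => g (x + t *: xi)).
Proof.
move=> uxi [sg bg]; split.
  move=> t; apply: (cvg_comp (fun t => x + t *: xi) g).
    exact: continuous_line.
  exact: (differentiable_continuous (sg [::] _)).
have [i xi0] : exists i, xi 0 i != 0.
  apply/existsP; rewrite -negb_forall; apply/negP => /forallP xi0.
  have : \sum_i xi 0 i ^+ 2 = 1 by [].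
  rewrite big1 => [/esym/eqP|j _]; first by rewrite oner_eq0.
  by rewrite (eqP (xi0 j)) expr0n.
have bgi q : exists C, forall y : 'rV[R]_n, `|y 0 i| ^+ q * `|g y| <= C.
  have [C hC] := bg (fun j => if j == i then q else 0%N) [::].
  exists C => y; have := hC y; rewrite normrM; congr (_ * _ <= _).
  rewrite (bigD1 i)//= eqxx big1 ?mulr1 ?normrX// => j /negPf->.
  by rewrite expr0.
move=> p; have [C hC] := bgi p; have [D hD] := bgi 0%N.
have xip : 0 < `|xi 0 i| ^+ p by rewrite exprn_gt0// normr_gt0.
(* From |y_i - x_i|^p <= 2^p (|y_i|^p + |x_i|^p), with [C] bounding |y_i|^p |g(y)| and [D] bounding
   |g(y)|. *)
exists (2 ^+ p * (C + `|x 0 i| ^+ p * D) / `|xi 0 i| ^+ p) => t t0.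
set y := x + t *: xi.
have yi : t * xi 0 i = y 0 i - x 0 i by rewrite !mxE addrC addKr.
rewrite ler_pdivlMr// mulrAC -{1}(ger0_norm t0) -exprMn -normrM yi.
apply: (@le_trans _ _ (2 ^+ p * (`|y 0 i| ^+ p + `|x 0 i| ^+ p) * `|g y|)).
  rewrite ler_wpM2r//; apply: le_trans (exprD_le _ _ _) => //.
  by rewrite lerXn2r ?nnegrE ?addr_ge0// ler_normB.
rewrite -mulrA ler_wpM2l ?exprn_ge0// mulrDl lerD// ler_wpM2l ?exprn_ge0//.
by have := hD y; rewrite expr0 mul1r.
Qed.

Lemma rapid_rcontract (R : realType) (n m : nat)
    (F : 'rV[R]_n -> m.-tuple 'I_n -> R) (x xi : 'rV[R]_n) :
  unit_sphere xi -> (forall i, real_schwartz (F^~ i)) ->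
  rapid (fun t => rcontract (F (x + t *: xi)) xi).
Proof.
move=> uxi sF; apply: rapid_sum => i; apply: rapidMr.
exact: (rapid_real_schwartz x uxi (sF i)).
Qed.

(** The one-dimensional result is applied to the contraction of F - G along the line through x: the
    sources x + s xi with small s >= 0 lie near x, and their data differ by zero. *)
Lemma real_beam_inj (R : realType) (n m k : nat)
    (F G : 'rV[R]_n -> m.-tuple 'I_n -> R) (x xi : 'rV[R]_n) :
  unit_sphere xi ->
  (forall i, real_schwartz (F^~ i)) -> (forall i, real_schwartz (G^~ i)) ->
  (\forall y \near x,
    \int[mu]_(t in `[0, +oo[) (t ^+ k * rcontract (F (y + t *: xi)) xi) =
    \int[mu]_(t in `[0, +oo[) (t ^+ k * rcontract (G (y + t *: xi)) xi)) ->
  rcontract (F x) xi = rcontract (G x) xi.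
Proof.
move=> uxi sF sG FG; have rF y := rapid_rcontract y uxi sF.
have rG y := rapid_rcontract y uxi sG.
have /nbhs_ballP[e /= e0 he] : \forall s \near (0 : R),
    \int[mu]_(t in `[0, +oo[) (t ^+ k * rcontract (F (x + s *: xi + t *: xi)) xi) =
    \int[mu]_(t in `[0, +oo[) (t ^+ k * rcontract (G (x + s *: xi + t *: xi)) xi).
  (* Writing x as the point of the line at parameter 0 lets continuity pull the neighbourhood back
     to s near 0. *)
  have FG0 : \forall y \near x + (0 : R) *: xi,
      \int[mu]_(t in `[0, +oo[) (t ^+ k * rcontract (F (y + t *: xi)) xi) =
      \int[mu]_(t in `[0, +oo[) (t ^+ k * rcontract (G (y + t *: xi)) xi).
    by rewrite scale0r addr0.
  exact: (continuous_line FG0).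
have := rapid_moment0 (k := k) (rapidB (rF x) (rG x)) e0.
rewrite scale0r addr0 => h; apply/eqP; rewrite -subr_eq0; apply/eqP/h.
move=> s s0 se.
under eq_Rintegral do rewrite scalerDl addrA mulrBr.
rewrite RintegralB//.
- apply/eqP; rewrite subr_eq0; apply/eqP/he.
  by rewrite /ball/= sub0r normrN ger0_norm.
- exact/rapid_integrable/rapidX.
- exact/rapid_integrable/rapidX.
Qed.

(** * Local uniqueness and reconstruction *)

Lemma Re_divergent_beam (R : realType) (n m k : nat)
    (f : 'rV[R]_n -> tensor R n m) (x xi : 'rV[R]_n) :
  complex.Re (divergent_beam k f x xi) =
  \int[mu]_(t in `[0, +oo[)
    (t ^+ k * rcontract (fun i => complex.Re (f (x + t *: xi) i)) xi).
Proof.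
rewrite /divergent_beam/=; apply: eq_Rintegral => t _.
by rewrite -Re_contract; case: (contract _ _) => a b /=; rewrite mul0r subr0.
Qed.

Lemma Im_divergent_beam (R : realType) (n m k : nat)
    (f : 'rV[R]_n -> tensor R n m) (x xi : 'rV[R]_n) :
  complex.Im (divergent_beam k f x xi) =
  \int[mu]_(t in `[0, +oo[)
    (t ^+ k * rcontract (fun i => complex.Im (f (x + t *: xi) i)) xi).
Proof.
rewrite /divergent_beam/=; apply: eq_Rintegral => t _.
by rewrite -Im_contract; case: (contract _ _) => a b /=; rewrite mul0r addr0.
Qed.

Lemma rcontractB (R : realType) (n m : nat) (v w : m.-tuple 'I_n -> R)
    (xi : 'rV[R]_n) :
  rcontract (fun i => v i - w i) xi = rcontract v xi - rcontract w xi.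
Proof. by rewrite /rcontract -sumrB; apply: eq_bigr => i _; rewrite mulrBl. Qed.

Lemma rcontract_inj (R : realType) (n m : nat) (v w : m.-tuple 'I_n.+1 -> R) :
  (forall (s : 'S_m) (i : m.-tuple 'I_n.+1), v [tuple tnth i (s j) | j < m] = v i) ->
  (forall (s : 'S_m) (i : m.-tuple 'I_n.+1), w [tuple tnth i (s j) | j < m] = w i) ->
  (forall xi, directions R n m xi -> rcontract v xi = rcontract w xi) ->
  v =1 w.
Proof.
move=> sv sw vw i; apply/eqP; rewrite -subr_eq0; apply/eqP.
apply: (@rcontract_eq0 _ _ _ (fun i => v i - w i)) => [s j|xi dxi].
  by rewrite sv sw.
by rewrite rcontractB vw// subrr.
Qed.

(** Real and imaginary parts are treated separately: the data fix the contraction at x with each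
    direction, and symmetry lets these contractions fix the components. *)
Lemma divergent_beam_inj (R : realType) (n m k : nat)
    (f g : 'rV[R]_n.+1 -> tensor R n.+1 m) (x : 'rV[R]_n.+1) :
  schwartz_symmetric_tensor_field f -> schwartz_symmetric_tensor_field g ->
  (\forall y \near x, forall xi, directions R n m xi ->
    divergent_beam k f y xi = divergent_beam k g y xi) ->
  f x = g x.
Proof.
move=> [symf sf] [symg sg] fg.
have ud xi : directions R n m xi -> unit_sphere xi.
  by move=> [p _ <-]; exact: normalize_unit.
apply/ffunP => i; apply/eqP; rewrite eq_complex; apply/andP; split; apply/eqP; move: i.
- apply: (@rcontract_inj _ _ _ (fun i => complex.Re (f x i))
    (fun i => complex.Re (g x i))) => [s i|s i|xi dxi].
  + by rewrite symf.
  + by rewrite symg.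
  apply: (@real_beam_inj _ _ _ k (fun x i => complex.Re (f x i))
    (fun x i => complex.Re (g x i)) x xi (ud _ dxi)) => [i|i|].
  + by have [] := sf i.
  + by have [] := sg i.
  by apply: filterS fg => y /(_ _ dxi); rewrite -!Re_divergent_beam => ->.
- apply: (@rcontract_inj _ _ _ (fun i => complex.Im (f x i))
    (fun i => complex.Im (g x i))) => [s i|s i|xi dxi].
  + by rewrite symf.
  + by rewrite symg.
  apply: (@real_beam_inj _ _ _ k (fun x i => complex.Im (f x i))
    (fun x i => complex.Im (g x i)) x xi (ud _ dxi)) => [i|i|].
  + by have [] := sf i.
  + by have [] := sg i.
  by apply: filterS fg => y /(_ _ dxi); rewrite -!Im_divergent_beam => ->.
Qed.

Theorem theorem1p2 (R : realType) (n m k : nat) (hn : (2 <= n)%N) :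
  exists Xi : set 'rV[R]_n,
    [/\ finite_set Xi, Xi `<=` @unit_sphere R n &
      exists rec : ('rV[R]_n -> 'rV[R]_n -> R[i]) -> 'rV[R]_n -> tensor R n m,
        pointwise_from Xi rec /\
        forall f : 'rV[R]_n -> tensor R n m,
          schwartz_symmetric_tensor_field f ->
          forall x : 'rV[R]_n, rec (divergent_beam k f) x = f x].
Proof.
case: n hn => // n _; exists (directions R n m); split.
- exact: finite_directions.
- by move=> xi [p _ <-]; exact: normalize_unit.
(* The possible values at x of a field whose data agree with [d] near x. Local uniqueness leaves at
   most one; for data of no field the procedure returns the zero tensor. *)
pose values (d : 'rV[R]_n.+1 -> 'rV[R]_n.+1 -> R[i]) x :=
  [set w : {ffun m.-tuple 'I_n.+1 -> R[i]} | exists f : 'rV[R]_n.+1 -> tensor R n.+1 m,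
    [/\ schwartz_symmetric_tensor_field f,
       \forall y \near x, forall xi, directions R n m xi ->
         d y xi = divergent_beam k f y xi & w = f x]].
exists (fun d x => xget [ffun=> 0] (values d x)); split.
(* Data that agree near x along [directions] admit the same candidates, hence the same choice. *)
- move=> d d' x dd'; congr xget; apply/seteqP; split => w [f [sf df ->]];
    exists f; split => //.
  + by apply: filterS2 dd' df => y e1 e2 xi dxi; rewrite -e1// e2.
  + by apply: filterS2 dd' df => y e1 e2 xi dxi; rewrite e1// e2.
- move=> f sf x; apply: xget_unique.
    by exists f; split => //; exact: filterE.
  by move=> w [g [sg fg ->]]; apply/esym/(divergent_beam_inj sf sg fg).
Qed.
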